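(* Let $R=R_1\times R_2\times\cdots\times R_m$ be a finite direct product of commutative rings and let $n,d\ge 0$ be integers. If $R$ is a $G$-$(n,d)$-ring, then $R_i$ is a $G$-$(n,d)$-ring for each $i=1,\dots,m$. The converse is true if $\sup\{\mathrm{G\text{-}gldim}(R_i)\mid i=1,\dots,m\}$ is finite; that is, if this supremum is finite and each $R_i$ is a $G$-$(n,d)$-ring, then $R$ is a $G$-$(n,d)$-ring.
   Context: All rings are commutative with identity and all modules are unital. An $R$-module $M$ is Gorenstein projective if there is an exact sequence of projective modules $\mathbf P=\cdots\to P_1\to P_0\to P^0\to P^1\to\cdots$ with $M\cong \mathrm{Im}(P_0\to P^0)$ such that $\mathrm{Hom}_R(-,Q)$ leaves $\mathbf P$ exact for every projective module $Q$. $\mathrm{Gpd}_R(M)$ is the minimal length of a resolution of $M$ by Gorenstein projective modules ($\infty$ if there is no finite one), and $\mathrm{G\text{-}gldim}(R)=\sup\{\mathrm{Gpd}_R(M)\mid M \text{ an } R\text{-module}\}$. For an integer $n\ge 0$, an $R$-module $M$ is $n$-presented if there is an exact sequence $F_n\to F_{n-1}\to\cdots\to F_0\to M\to 0$ with each $F_i$ a finitely generated free $R$-module. For integers $n,d\ge 0$, $R$ is a $G$-$(n,d)$-ring if every $n$-presented $R$-module $M$ satisfies $\mathrm{Gpd}_R(M)\le d$. *)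

(* Defs.v *)
From HB Require Import structures.
From mathcomp Require Import all_boot all_order all_algebra.
From mathcomp Require Import boolp.

Set Implicit Arguments.
Unset Strict Implicit.
Unset Printing Implicit Defensive.

Import GRing.Theory.
Local Open Scope ring_scope.

(* MathComp only provides {ffun I -> R} (constant family) as a product ring. *)
Section ProductRing.
Variables (I : finType) (R : I -> comPzRingType).

Definition prod_ring : Type := {dffun forall i, R i}.
HB.instance Definition _ := Choice.on prod_ring.

Implicit Types x y z : prod_ring.

Definition prod_zero : prod_ring := [ffun i => 0 : R i].
Definition prod_opp x : prod_ring := [ffun i => - x i].
Definition prod_add x y : prod_ring := [ffun i => x i + y i].
Definition prod_one : prod_ring := [ffun i => 1 : R i].
Definition prod_mul x y : prod_ring := [ffun i => x i * y i].

Fact prod_addA : associative prod_add.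
Proof. by move=> x y z; apply/ffunP => i; rewrite !ffunE addrA. Qed.
Fact prod_addC : commutative prod_add.
Proof. by move=> x y; apply/ffunP => i; rewrite !ffunE addrC. Qed.
Fact prod_add0 : left_id prod_zero prod_add.
Proof. by move=> x; apply/ffunP => i; rewrite !ffunE add0r. Qed.
Fact prod_addN : left_inverse prod_zero prod_opp prod_add.
Proof. by move=> x; apply/ffunP => i; rewrite !ffunE addNr. Qed.

HB.instance Definition _ :=
  GRing.isZmodule.Build prod_ring prod_addA prod_addC prod_add0 prod_addN.

Fact prod_mulA : associative prod_mul.
Proof. by move=> x y z; apply/ffunP => i; rewrite !ffunE mulrA. Qed.
Fact prod_mulC : commutative prod_mul.
Proof. by move=> x y; apply/ffunP => i; rewrite !ffunE mulrC. Qed.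
Fact prod_mul1 : left_id prod_one prod_mul.
Proof. by move=> x; apply/ffunP => i; rewrite !ffunE mul1r. Qed.
Fact prod_mulDl : left_distributive prod_mul prod_add.
Proof. by move=> x y z; apply/ffunP => i; rewrite !ffunE mulrDl. Qed.

HB.instance Definition _ :=
  GRing.Zmodule_isComPzRing.Build prod_ring
    prod_mulA prod_mulC prod_mul1 prod_mulDl.

End ProductRing.

Variant enat := Fin of nat | Infty.

Definition enat_le (a b : enat) : bool :=
  match a, b with
  | _, Infty => true
  | Infty, Fin _ => false
  | Fin m, Fin n => (m <= n)%N
  end.

(* The least n satisfying P, and Infty when there is none. *)
Definition emin (P : nat -> Prop) : enat :=
  match pselect (exists n, `[< P n >]) with
  | left exP => Fin (ex_minn exP)
  | right _ => Infty
  end.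

(* The least upper bound of the extended naturals satisfying A. *)
Definition esup (A : enat -> Prop) : enat :=
  emin (fun n => forall a, A a -> enat_le a (Fin n)).

Lemma emin_leP (P : nat -> Prop) (d : nat) :
  enat_le (emin P) (Fin d) <-> exists2 n, (n <= d)%N & P n.
Proof.
rewrite /emin; case: pselect => [exP|nexP] /=.
  case: ex_minnP => n /asboolP Pn min_n; split=> [le_nd|[k le_kd Pk]].
    by exists n.
  by apply: leq_trans le_kd; apply: min_n; apply/asboolP.
by split=> // -[n _ Pn]; case: nexP; exists n; apply/asboolP.
Qed.

Lemma esup_leP (A : enat -> Prop) (b : enat) :
  enat_le (esup A) b <-> forall a, A a -> enat_le a b.
Proof.
case: b => [d|]; last by split=> [_ [] //|]; case: (esup A).
split=> [/emin_leP[n le_nd ubn] a /ubn|ubd]; last by apply/emin_leP; exists d.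
by case: a => //= k le_kn; apply: leq_trans le_nd.
Qed.

Section HomologicalAlgebra.
Variable R : comPzRingType.
Implicit Types M N P Q U V W : lmodType R.

Definition surj U V (f : {linear U -> V}) : Prop :=
  forall v, exists u, f u = v.

Definition exact_at U V W (f : {linear U -> V}) (g : {linear V -> W}) : Prop :=
  forall v, g v = 0 <-> exists u, f u = v.

Definition projective P : Prop :=
  forall M N (g : {linear M -> N}) (f : {linear P -> N}),
    surj g -> exists h : {linear P -> M}, forall x, g (h x) = f x.

(* The functor Hom(-, Q) turns U -f-> V -g-> W into a sequence exact at
   Hom(V, Q). *)
Definition hom_exact_at U V W (f : {linear U -> V}) (g : {linear V -> W}) Q
  : Prop :=
  forall a : {linear V -> Q},
    (forall u, a (f u) = 0) <->
    exists b : {linear W -> Q}, forall v, b (g v) = a v.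

(* An isomorphism of M with Im f is an injective map M -> V of image Im f. *)
Definition iso_image M U V (f : {linear U -> V}) : Prop :=
  exists2 phi : {linear M -> V}, injective phi
    & forall v, (exists x, phi x = v) <-> (exists u, f u = v).

(* The two-sided sequence is indexed by int, the differentials raising the
   degree: P_j sits in degree - 1 - j and P^j in degree j, so that P_0 -> P^0
   is the differential from degree -1 to degree -1 + 1 = 0. *)
Definition gorenstein_projective M : Prop :=
  exists (P : int -> lmodType R) (del : forall k, {linear P k -> P (k + 1)}),
    [/\ forall k, projective (P k),
        forall k, exact_at (del k) (del (k + 1)),
        forall Q, projective Q ->
          forall k, hom_exact_at (del k) (del (k + 1)) Q
      & iso_image M (del (-1))].

(* Sequences ... -> X 1 -> X 0 -> M of linear maps. *)
Record augmented M := Augmented {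
  term :> nat -> lmodType R;
  diff : forall k, {linear term k.+1 -> term k};
  aug : {linear term 0%N -> M}
}.

(* Exactness of X n -> X n.-1 -> ... -> X 0 -> M -> 0, with no condition at
   X n. *)
Definition exact_from M (X : augmented M) (n : nat) : Prop :=
  [/\ surj (aug X),
      (0 < n)%N -> exact_at (diff X 0) (aug X)
    & forall k, (k.+1 < n)%N -> exact_at (diff X k.+1) (diff X k)].

(* 0 -> X d -> ... -> X 0 -> M -> 0 is an exact sequence of Gorenstein
   projective modules; it is extended by X k = 0 for k > d. *)
Definition gproj_resolution M (X : augmented M) (d : nat) : Prop :=
  [/\ forall k, gorenstein_projective (X k),
      forall n, exact_from X n
    & forall k, (d < k)%N -> forall x : X k, x = 0].

Definition Gpd M : enat :=
  emin (fun d => exists X : augmented M, gproj_resolution X d).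

Definition G_gldim : enat := esup (fun a => exists M, a = Gpd M).

Definition fg_free U : Prop :=
  exists r (phi : {linear 'rV[R]_r -> U}), bijective phi.

(* The terms X k and the differentials from X k with k > n are irrelevant. *)
Definition presented (n : nat) M : Prop :=
  exists X : augmented M,
    (forall k, (k <= n)%N -> fg_free (X k)) /\ exact_from X n.

Definition G_ring (n d : nat) : Prop :=
  forall M, presented n M -> enat_le (Gpd M) (Fin d).

End HomologicalAlgebra.

(* Main.v *)
Require Import Defs.
From HB Require Import structures.
From mathcomp Require Import all_boot all_order all_algebra.
From mathcomp Require Import boolp.

Set Implicit Arguments.
Unset Strict Implicit.
Unset Printing Implicit Defensive.

Import GRing.Theory.
Local Open Scope ring_scope.

(** Write [R] for the product ring and [e_i] for the idempotent of its [i]-th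
    factor. An [R]-module [M] is the direct sum of the [e_i M], and this makes
    [R]-modules the same thing as families of [R i]-modules: [component i]
    sends [M] to [e_i M], and [prod_module] sends a family to its product.
    Every notion in the theorem can be read componentwise through this
    equivalence, and the result follows: a module is [n]-presented over [R] iff
    its components are, and its Gorenstein projective dimension is at most [d]
    iff this holds for all its components.

    For dimensions, both functors preserve exactness, so the point is that they
    preserve projectivity and the exactness of [Hom] into projectives. Both
    facts come from adjunctions, which move the test module to the other ring:
    [Hom_(R i)(e_i M, N)] is [Hom_R(M, restriction N)], where [restriction] is
    restriction of scalars along the projection, and [Hom_R(prod_module M, N)]
    is the product of the [Hom_(R i)(M i, e_i N)]. The restriction of a
    projective module is projective because restriction is also left adjoint to
    the exact functor [component i]. Hence complete resolutions and resolutions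
    are carried over term by term ([component_gproj_resolution],
    [prod_gproj_resolution]).

    Free modules are the one place where the equivalence is not term by term:
    a product of free modules over the factors is free over [R] only when all
    of them have the same rank. Finite free presentations of the factors are
    therefore first enlarged by contractible complexes until their ranks agree
    in every degree ([presented_of_rank], [prod_module_presented]).

    If [R] is a [G]-[(n,d)]-ring and [M] is an [n]-presented [R i]-module, the
    family with [M] at [i] and [0] elsewhere has an [n]-presented product,
    whose [i]-th component is [M] again. Conversely, an [n]-presented
    [R]-module is the product of its components, which are [n]-presented. *)

(** * Linear maps and resolutions over a fixed ring *)

Section FixedRing.
Variable R : comPzRingType.
Implicit Types M N U V W : lmodType R.

Definition linear_of U V (f : U -> V) (lin_f : linear f) : {linear U -> V} :=
  HB.pack f (GRing.isLinear.Build R U V *:%R f lin_f).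

Lemma inj_surj_bijective U V (f : {linear U -> V}) :
  injective f -> surj f -> bijective f.
Proof.
move=> inj_f surj_f.
have surjb v : exists u, f u == v by have [u <-] := surj_f v; exists u.
have fK v : f (xchoose (surjb v)) = v by apply/eqP/(xchooseP (surjb v)).
by exists (fun v => xchoose (surjb v)) => // u; apply: inj_f.
Qed.

Lemma bijective_surj U V (f : {linear U -> V}) : bijective f -> surj f.
Proof. by case=> g _ fK v; exists (g v). Qed.

Lemma Gpd_leP M d :
  enat_le (Gpd M) (Fin d) <-> exists X : augmented M, gproj_resolution X d.
Proof.
split=> [/emin_leP[k le_kd [X [gX exX X0]]]|exX].
  by exists X; split=> // j lt_dj; apply: X0; apply: leq_ltn_trans lt_dj.
by apply/emin_leP; exists d.
Qed.

Lemma gproj_resolution_iso M N (f : {linear M -> N}) d :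
    bijective f ->
  (exists X : augmented M, gproj_resolution X d) ->
  exists X : augmented N, gproj_resolution X d.
Proof.
move=> bij_f [X [gX exX X0]].
have inj_f := bij_inj bij_f.
exists (Augmented (@diff _ _ X) (f \o aug X : {linear X 0%N -> N})).
split=> // n; have [surjX ex0 exS] := exX n; split=> //=.
  move=> y; have [x <-] := bijective_surj bij_f y.
  by have [u <-] := surjX x; exists u.
move=> n_gt0 v /=; rewrite -(ex0 n_gt0 v).
by split=> [|->]; rewrite ?linear0 // -(linear0 f) => /inj_f.
Qed.

Definition free_of_rank r U : Prop :=
  exists phi : {linear 'rV[R]_r -> U}, bijective phi.

Lemma free_of_rank_row r : free_of_rank r 'rV[R]_r.
Proof.
have lin_id : linear (@id 'rV[R]_r) by [].
by exists (linear_of lin_id); exists id.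
Qed.

Lemma free_of_rankD r s U V :
  free_of_rank r U -> free_of_rank s V -> free_of_rank (r + s) (U * V)%type.
Proof.
move=> [f [f' fK f'K]] [g [g' gK g'K]].
pose h (x : 'rV[R]_(r + s)) : (U * V)%type := (f (lsubmx x), g (rsubmx x)).
have lin_h : linear h by move=> a x y; rewrite /h !linearP.
exists (linear_of lin_h).
exists (fun y => row_mx (f' y.1) (g' y.2)) => [x|[y z]] /=.
  by rewrite fK gK hsubmxK.
by rewrite /h row_mxKl row_mxKr f'K g'K.
Qed.

(** Adding the contractible complex whose degree [k] term is
    [R^(b k.+1) * R^(b k)] and whose differential is [(u, v) |-> (v, 0)]
    changes the ranks without affecting exactness. The condition [b 0 = 0]
    makes this complex exact in degree 0, where its augmentation is zero. *)
Section Padding.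
Variables (M : lmodType R) (X : augmented M) (b : nat -> nat).
Hypothesis b0 : b 0 = 0%N.

Definition padded_term k : lmodType R :=
  (X k * ('rV[R]_(b k.+1) * 'rV[R]_(b k)))%type.

Definition padded_diff_fun k (x : padded_term k.+1) : padded_term k :=
  (diff X k x.1, (x.2.2, 0)).

Lemma padded_diff_linear k : linear (@padded_diff_fun k).
Proof.
move=> a x y; rewrite /padded_diff_fun linearP /=.
by congr (_, (_, _)) => /=; rewrite scaler0 addr0.
Qed.

Definition padded_aug_fun (x : padded_term 0) : M := aug X x.1.

Lemma padded_aug_linear : linear padded_aug_fun.
Proof. by move=> a x y; rewrite /padded_aug_fun linearP. Qed.

Definition padded : augmented M :=
  Augmented (fun k => linear_of (@padded_diff_linear k))
            (linear_of padded_aug_linear).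

Lemma padded_exact n : exact_from X n -> exact_from padded n.
Proof.
case=> surjX ex0 exS; split.
- by move=> y; have [u <-] := surjX y; exists (u, (0, 0)).
- move=> n_gt0 [x [u v]] /=; rewrite /padded_aug_fun /padded_diff_fun /=.
  have v0 : v = 0 by apply/rowP => -[i lt_i]; exfalso; rewrite b0 in lt_i.
  rewrite (ex0 n_gt0 x); split=> [[z <-]|[[z [w t]] /= [<- _ _]]].
    by exists (z, (0, u)); rewrite v0.
  by exists z.
move=> k lt_kn [x [u v]] /=; rewrite /padded_diff_fun /=; split.
  by case=> /(exS k lt_kn)[z <-] ->; exists (z, (0, u)).
case=> [[z [w t]]] [<- _ <-]; congr (_, _).
by apply/(exS k lt_kn); exists z.
Qed.

Lemma padded_rank k r :
  free_of_rank r (X k) -> free_of_rank (r + (b k.+1 + b k)) (padded k).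
Proof.
move=> rkX; apply: free_of_rankD => //.
by apply: free_of_rankD; apply: free_of_rank_row.
Qed.

End Padding.

(** Padding adds [b k.+1 + b k] to the rank in degree [k], so a prescribed rank
    [s k] determines [b k.+1] from [b k]; the growth conditions on [s] keep
    this difference nonnegative. *)
Lemma presented_of_rank n M (X : augmented M) (r s : nat -> nat) :
    (forall k, (k <= n)%N -> free_of_rank (r k) (X k)) ->
    exact_from X n ->
    (r 0 <= s 0)%N -> (forall k, r k.+1 + s k <= s k.+1)%N ->
  exists2 Y : augmented M,
    (forall k, (k <= n)%N -> free_of_rank (s k) (Y k)) & exact_from Y n.
Proof.
move=> rkX exX le0 leS.
(* [b k.+1] is what is missing from [r k + b k] to reach [s k]. *)
pose b := fix b k := if k is k'.+1 then (s k' - r k' - b k')%N else 0%N.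
have bS k : (r k + (b k.+1 + b k) = s k)%N.
  suff : (r k + b k <= s k)%N.
    by rewrite /= -/(b k) => le; rewrite addnCA -subnDA subnK.
  case: k => [|k]; first by rewrite addn0.
  apply: leq_trans (leS k); rewrite leq_add2l /=.
  by rewrite -subnDA leq_subr.
exists (padded X b); last exact: padded_exact.
by move=> k le_kn; rewrite -bS; apply: padded_rank; apply: rkX.
Qed.

End FixedRing.

(** * Modules over a product ring and over its factors *)

Section Product.
Variables (I : finType) (R : I -> comPzRingType).

Lemma prod_ringDE (a b : prod_ring R) i : (a + b) i = a i + b i.
Proof. exact: ffunE. Qed.

Lemma prod_ringME (a b : prod_ring R) i : (a * b) i = a i * b i.
Proof. exact: ffunE. Qed.

Lemma prod_ring1E i : (1 : prod_ring R) i = 1.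
Proof. exact: ffunE. Qed.

(** A name for the [i]-th projection, so that it can carry its structure of
    additive map. *)
Definition coord i (a : prod_ring R) : R i := a i.

Lemma coord_zmod_morphism i : zmod_morphism (@coord i).
Proof.
by move=> a b; rewrite /coord prod_ringDE; congr (_ + _); apply: ffunE.
Qed.

HB.instance Definition _ i :=
  GRing.isZmodMorphism.Build (prod_ring R) (R i) (@coord i)
    (@coord_zmod_morphism i).

(** Additive and multiplicative, but sending [1] to the idempotent [e_i]. *)
Definition inj_ring i (r : R i) : prod_ring R :=
  finfun (dfwith (fun j => 0 : R j) r).

Lemma inj_ring_at i (r : R i) : inj_ring r i = r.
Proof. by rewrite ffunE dfwith_in. Qed.

Lemma inj_ring_out i j (r : R i) : i != j -> inj_ring r j = 0.
Proof. by move=> ij; rewrite ffunE dfwith_out. Qed.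

Lemma inj_ring_zmod_morphism i : zmod_morphism (@inj_ring i).
Proof.
move=> r s; apply/ffunP => j.
rewrite -/(coord j _) -/(coord j (_ - _)) raddfB /= /coord.
have [<-|ij] := eqVneq i j; first by rewrite !inj_ring_at.
by rewrite !inj_ring_out ?subr0.
Qed.

HB.instance Definition _ i :=
  GRing.isZmodMorphism.Build (R i) (prod_ring R) (@inj_ring i)
    (@inj_ring_zmod_morphism i).

Lemma mul_inj_ring i (a : prod_ring R) (r : R i) :
  a * inj_ring r = inj_ring (a i * r).
Proof.
apply/ffunP => j; rewrite prod_ringME.
have [<-|ij] := eqVneq i j; first by rewrite !inj_ring_at.
by rewrite !inj_ring_out ?mulr0.
Qed.

Lemma sum_inj_ring (a : prod_ring R) : \sum_i inj_ring (a i) = a.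
Proof.
apply/ffunP => j; rewrite -/(coord j _) raddf_sum (bigD1 j) //= big1.
  by rewrite addr0 /coord inj_ring_at.
by move=> i ij; rewrite /coord inj_ring_out.
Qed.

(** [component i M] is the direct factor [e_i M] of an [R]-module [M], with
    [e_i] the idempotent of the [i]-th factor; [R i] acts through
    [inj_ring], which is unital on it. *)
Section Component.
Variables (i : I) (M : lmodType (prod_ring R)).

Definition fixed_by_idem : pred M := fun x => inj_ring (1 : R i) *: x == x.

Lemma fixed_by_idem_zmod_closed : zmod_closed fixed_by_idem.
Proof.
split=> [|x y /eqP ex /eqP ey]; first by rewrite unfold_in scaler0.
by rewrite unfold_in scalerBr ex ey.
Qed.

HB.instance Definition _ :=
  GRing.isZmodClosed.Build M fixed_by_idem fixed_by_idem_zmod_closed.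

Record component := Component { cval :> M; cvalP : cval \in fixed_by_idem }.
HB.instance Definition _ := [isSub for cval].
HB.instance Definition _ := [Choice of component by <:].
HB.instance Definition _ := [SubChoice_isSubZmodule of component by <:].

Lemma idem_cval (x : component) : inj_ring (1 : R i) *: cval x = cval x.
Proof. by apply/eqP; apply: (cvalP x). Qed.

Fact cproj_subproof (x : M) : inj_ring (1 : R i) *: x \in fixed_by_idem.
Proof. by rewrite unfold_in scalerA mul_inj_ring inj_ring_at mulr1. Qed.

Definition cproj (x : M) : component := Component (cproj_subproof x).

Lemma cval_inj : injective cval.
Proof. exact: val_inj. Qed.

Lemma cvalD x y : cval (x + y) = cval x + cval y.
Proof. by []. Qed.

Lemma cvalK x : cproj (cval x) = x.
Proof. by apply: cval_inj; rewrite /= idem_cval. Qed.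

Definition component_scale (r : R i) (x : component) : component :=
  cproj (inj_ring r *: cval x).

Lemma cval_component_scale r x :
  cval (component_scale r x) = inj_ring r *: cval x.
Proof. by rewrite /= scalerA mul_inj_ring inj_ring_at mul1r. Qed.

Fact component_scaleA r s x :
  component_scale r (component_scale s x) = component_scale (r * s) x.
Proof.
apply: cval_inj; rewrite [LHS]cval_component_scale !cval_component_scale.
by rewrite scalerA mul_inj_ring inj_ring_at.
Qed.

Fact component_scale1 : left_id 1 component_scale.
Proof.
by move=> x; apply: cval_inj; rewrite [LHS]cval_component_scale idem_cval.
Qed.

Fact component_scaleDr : right_distributive component_scale +%R.
Proof.
by move=> r x y; apply: cval_inj; rewrite /= !scalerDr.
Qed.

Fact component_scaleDl x : {morph component_scale^~ x : r s / r + s}.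
Proof.
by move=> r s; apply: cval_inj; rewrite /= raddfD /= scalerDl scalerDr.
Qed.

HB.instance Definition _ :=
  GRing.Zmodule_isLmodule.Build (R i) component
    component_scaleA component_scale1 component_scaleDr component_scaleDl.

Lemma cvalZ_inj r (x : component) : cval (r *: x) = inj_ring r *: cval x.
Proof. exact: cval_component_scale. Qed.

(** Both rings act on [e_i M] compatibly because [a * e_i] is the image of
    [a i] under [inj_ring]. *)
Lemma cvalZ (a : prod_ring R) (x : component) : cval (a i *: x) = a *: cval x.
Proof.
by rewrite cvalZ_inj -[in RHS]idem_cval scalerA mul_inj_ring mulr1.
Qed.

End Component.
Arguments cproj i {M} x.

Section ComponentMap.
Variables (i : I) (M N : lmodType (prod_ring R)) (f : {linear M -> N}).

Definition component_fun (x : component i M) : component i N :=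
  cproj i (f (cval x)).

Lemma cval_component_fun x : cval (component_fun x) = f (cval x).
Proof. by rewrite /= -linearZ idem_cval. Qed.

Lemma component_fun_linear : linear component_fun.
Proof.
move=> r x y; apply: cval_inj.
by rewrite cvalD cvalZ_inj !cval_component_fun cvalD cvalZ_inj linearP.
Qed.

Definition component_map : {linear component i M -> component i N} :=
  linear_of component_fun_linear.

Lemma cval_component_map x : cval (component_map x) = f (cval x).
Proof. exact: cval_component_fun. Qed.

Lemma component_map_eq0 x : component_map x = 0 <-> f (cval x) = 0.
Proof.
rewrite -cval_component_map; split=> [->|fx0] //.
by apply: cval_inj; rewrite fx0.
Qed.

(** If [f x] lies in [e_i N], then [f (e_i x) = f x]. *)
Lemma component_map_image y :
  (exists x, component_map x = y) <-> (exists x, f x = cval y).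
Proof.
split=> [[x <-]|[x fx]]; first by exists (cval x); rewrite cval_component_map.
exists (cproj i x); apply: cval_inj.
by rewrite cval_component_map /= linearZ /= fx idem_cval.
Qed.

End ComponentMap.

Lemma component_map_exact i (U V W : lmodType (prod_ring R))
    (f : {linear U -> V}) (g : {linear V -> W}) :
  exact_at f g -> exact_at (component_map i f) (component_map i g).
Proof. by move=> ex v; rewrite component_map_eq0 component_map_image. Qed.

Lemma component_map_surj i (U V : lmodType (prod_ring R))
    (f : {linear U -> V}) :
  surj f -> surj (component_map i f).
Proof. by move=> sf v; apply/component_map_image. Qed.

(** Restriction of scalars along the projection onto the [i]-th factor; it is
    adjoint to [component i] on both sides. *)
Section Restriction.
Variables (i : I) (M : lmodType (R i)).

Definition restriction : Type := M.
HB.instance Definition _ := GRing.Zmodule.copy restriction M.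

Definition restriction_scale (a : prod_ring R) (x : restriction) :
    restriction :=
  a i *: (x : M).

Fact restriction_scaleA a b x :
  restriction_scale a (restriction_scale b x) = restriction_scale (a * b) x.
Proof. by rewrite /restriction_scale scalerA prod_ringME. Qed.

Fact restriction_scale1 : left_id 1 restriction_scale.
Proof. by move=> x; rewrite /restriction_scale prod_ring1E scale1r. Qed.

Fact restriction_scaleDr : right_distributive restriction_scale +%R.
Proof. by move=> a x y; apply: scalerDr. Qed.

Fact restriction_scaleDl x : {morph restriction_scale^~ x : a b / a + b}.
Proof. by move=> a b; rewrite /restriction_scale prod_ringDE scalerDl. Qed.

HB.instance Definition _ :=
  GRing.Zmodule_isLmodule.Build (prod_ring R) restriction
    restriction_scaleA restriction_scale1
    restriction_scaleDr restriction_scaleDl.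

Lemma restrictionZ a (x : restriction) : a *: x = (a i *: (x : M) : M).
Proof. by []. Qed.

End Restriction.

Lemma restriction_map_linear i (M N : lmodType (R i)) (f : {linear M -> N}) :
  linear (f : restriction M -> restriction N).
Proof. by move=> a x y; rewrite !restrictionZ linearP. Qed.

Definition restriction_map i (M N : lmodType (R i)) (f : {linear M -> N}) :
  {linear restriction M -> restriction N} :=
  linear_of (restriction_map_linear f).

(** The bijection [Hom_R(M, restriction N) = Hom_(R i)(component i M, N)]. *)
Section RestrictionAdjunction.
Variables (i : I) (M : lmodType (prod_ring R)) (N : lmodType (R i)).

Lemma to_restriction_linear (f : {linear component i M -> N}) :
  linear (fun x : M => f (cproj i x) : restriction N).
Proof.
move=> a x y; rewrite restrictionZ /= -linearP; congr (f _); apply: cval_inj.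
by rewrite cvalD cvalZ /= scalerDr !scalerA mulrC.
Qed.

Definition to_restriction f : {linear M -> restriction N} :=
  linear_of (to_restriction_linear f).

Lemma of_restriction_linear (f : {linear M -> restriction N}) :
  linear (fun x : component i M => f (cval x) : N).
Proof.
move=> r x y; rewrite cvalD cvalZ_inj linearD linearZ /=.
by rewrite restrictionZ inj_ring_at.
Qed.

Definition of_restriction f : {linear component i M -> N} :=
  linear_of (of_restriction_linear f).

Lemma to_restrictionE f x : to_restriction f (cval x) = f x.
Proof. by rewrite /= cvalK. Qed.

End RestrictionAdjunction.

(** By adjunction, a lifting problem for [e_i P] over [R i] is one for [P] over
    the product ring, with both other modules restricted. *)
Lemma component_projective i (P : lmodType (prod_ring R)) :
  projective P -> projective (component i P).
Proof.
move=> projP M N g f surjg.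
have [h hP] := projP _ _ (restriction_map g) (to_restriction f) surjg.
exists (of_restriction h) => x.
by have := hP (cval x); rewrite to_restrictionE.
Qed.

(** Restriction is also left adjoint to [component i]: a map out of the
    restriction of an [R i]-module takes its values in [e_i N]. *)
Lemma restriction_projective i (Q : lmodType (R i)) :
  projective Q -> projective (restriction Q).
Proof.
move=> projQ M N g f surjg.
have valfP (x : Q) : f x \in fixed_by_idem i (M := N).
  by rewrite unfold_in -linearZ /= restrictionZ inj_ring_at scale1r.
have lin_f : linear (fun x : Q => Component (valfP x)).
  move=> r x y; apply: cval_inj; rewrite cvalD cvalZ_inj /= -linearP.
  by rewrite restrictionZ inj_ring_at.
have surjgi := component_map_surj (i := i) surjg.
have [h hP] := projQ _ _ _ (linear_of lin_f) surjgi.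
have lin_h : linear (fun x : restriction Q => cval (h x)).
  by move=> a x y; rewrite restrictionZ linearP cvalD cvalZ.
by exists (linear_of lin_h) => x; rewrite /= -cval_component_map hP.
Qed.

(** Under the adjunction, maps from [e_i V] to [Q] are the maps from [V] to
    [restriction Q], and composition with [f] and [g] is respected. *)
Lemma component_hom_exact i (U V W : lmodType (prod_ring R))
    (f : {linear U -> V}) (g : {linear V -> W}) (Q : lmodType (R i)) :
  hom_exact_at f g (restriction Q) ->
  hom_exact_at (component_map i f) (component_map i g) Q.
Proof.
move=> ex a; have [kill_lift lift_kill] := ex (to_restriction a); split.
  move=> killa; have [|b bP] := kill_lift.
    move=> u; rewrite -[RHS](killa (cproj i u)); congr (a _).
    by apply: cval_inj; rewrite cval_component_map /= linearZ.
  exists (of_restriction b) => v.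
  by rewrite /= -linearZ idem_cval bP to_restrictionE.
case=> b bP u; rewrite -to_restrictionE cval_component_map.
apply: lift_kill; exists (to_restriction b) => v.
rewrite /= -bP; congr (b _).
by apply: cval_inj; rewrite cval_component_map /= linearZ.
Qed.

(** The component of a complete resolution is one: for projective [Q] over
    [R i], the test module [restriction Q] is projective again. *)
Lemma component_gproj i (M : lmodType (prod_ring R)) :
  gorenstein_projective M -> gorenstein_projective (component i M).
Proof.
case=> P [del [projP ex hex [phi inj_phi im_phi]]].
exists (fun k => component i (P k)), (fun k => component_map i (del k)); split.
- by move=> k; apply: component_projective.
- by move=> k; apply: component_map_exact.
- move=> Q projQ k; apply: component_hom_exact; apply: hex.
  exact: restriction_projective.
exists (component_map i phi).
  move=> x y /(congr1 (@cval _ _)); rewrite !cval_component_map.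
  by move=> /inj_phi/cval_inj.
by move=> v; rewrite !component_map_image.
Qed.

Definition component_augmented i (M : lmodType (prod_ring R))
    (X : augmented M) : augmented (component i M) :=
  Augmented (term := fun k => component i (X k) : lmodType (R i))
    (fun k => component_map i (diff X k)) (component_map i (aug X)).

Lemma component_exact_from i M (X : augmented M) n :
  exact_from X n -> exact_from (component_augmented i X) n.
Proof.
case=> surjX ex0 exS; split; first exact: component_map_surj.
  by move=> n_gt0; apply/component_map_exact/ex0.
by move=> k lt_kn; apply/component_map_exact/exS.
Qed.

Lemma component_gproj_resolution i M (X : augmented M) d :
  gproj_resolution X d -> gproj_resolution (component_augmented i X) d.
Proof.
case=> gX exX X0; split=> [k|n|k lt_dk x].
- exact: component_gproj.
- exact: component_exact_from.
by apply: cval_inj; apply: X0.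
Qed.

(** [e_i R^r] is [(R i)^r], through [inj_ring] applied to each coordinate. *)
Lemma component_fg_free i (U : lmodType (prod_ring R)) :
  fg_free U -> fg_free (component i U).
Proof.
case=> r [phi bij_phi].
have lin_psi : linear (fun x : 'rV[R i]_r =>
    cproj i (phi (map_mx (@inj_ring i) x))).
  move=> a x y; apply: cval_inj; rewrite cvalD cvalZ_inj /=.
  rewrite -!linearZ /= -linearZ -linearD /=; congr (phi _).
  apply/rowP => k.
  by rewrite !mxE raddfD mulrDr /= !mul_inj_ring !inj_ring_at.
exists r, (linear_of lin_psi); apply: inj_surj_bijective.
  move=> x y /(congr1 (@cval _ _)) /=; rewrite -!linearZ.
  move=> /(bij_inj bij_phi)/rowP eq_xy; apply/rowP => k.
  have := congr1 (@coord i) (eq_xy k).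
  by rewrite !mxE !mul_inj_ring /coord !inj_ring_at !mul1r.
move=> u; have [x phix] := bijective_surj bij_phi (cval u).
exists (map_mx (@coord i) x); apply: cval_inj.
rewrite /= -linearZ -idem_cval -phix -linearZ /=; congr (phi _).
apply/rowP => k; rewrite !mxE mul_inj_ring inj_ring_at mul1r.
by rewrite [RHS]mulrC mul_inj_ring mulr1.
Qed.

Lemma component_presented i n (M : lmodType (prod_ring R)) :
  presented n M -> presented n (component i M).
Proof.
case=> X [frX exX]; exists (component_augmented i X); split.
  by move=> k le_kn; apply/component_fg_free/frX.
exact: component_exact_from.
Qed.

(** * Products of modules over the factors *)

Section ProductModule.
Variable M : forall i, lmodType (R i).

Definition prod_module : Type := {dffun forall i, M i}.
HB.instance Definition _ := Choice.on prod_module.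

Implicit Types (a b : prod_ring R) (x y z : prod_module).

Definition prod_module_zero : prod_module := [ffun i => 0 : M i].
Definition prod_module_opp x : prod_module := [ffun i => - x i].
Definition prod_module_add x y : prod_module := [ffun i => x i + y i].
Definition prod_module_scale a x : prod_module := [ffun i => a i *: x i].

Fact prod_module_addA : associative prod_module_add.
Proof. by move=> x y z; apply/ffunP => i; rewrite !ffunE addrA. Qed.
Fact prod_module_addC : commutative prod_module_add.
Proof. by move=> x y; apply/ffunP => i; rewrite !ffunE addrC. Qed.
Fact prod_module_add0 : left_id prod_module_zero prod_module_add.
Proof. by move=> x; apply/ffunP => i; rewrite !ffunE add0r. Qed.
Fact prod_module_addN :
  left_inverse prod_module_zero prod_module_opp prod_module_add.
Proof. by move=> x; apply/ffunP => i; rewrite !ffunE addNr. Qed.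

HB.instance Definition _ := GRing.isZmodule.Build prod_module
  prod_module_addA prod_module_addC prod_module_add0 prod_module_addN.

Lemma prod_moduleDE x y i : (x + y) i = x i + y i.
Proof. exact: ffunE. Qed.

Lemma prod_module0E i : (0 : prod_module) i = 0.
Proof. exact: ffunE. Qed.

Fact prod_module_scaleA a b x :
  prod_module_scale a (prod_module_scale b x) = prod_module_scale (a * b) x.
Proof. by apply/ffunP => i; rewrite !ffunE scalerA. Qed.
Fact prod_module_scale1 : left_id 1 prod_module_scale.
Proof. by move=> x; apply/ffunP => i; rewrite !ffunE scale1r. Qed.
Fact prod_module_scaleDr : right_distributive prod_module_scale +%R.
Proof. by move=> a x y; apply/ffunP => i; rewrite !ffunE scalerDr. Qed.
Fact prod_module_scaleDl x : {morph prod_module_scale^~ x : a b / a + b}.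
Proof. by move=> a b; apply/ffunP => i; rewrite !ffunE scalerDl. Qed.

HB.instance Definition _ :=
  GRing.Zmodule_isLmodule.Build (prod_ring R) prod_module
  prod_module_scaleA prod_module_scale1 prod_module_scaleDr prod_module_scaleDl.

Lemma prod_moduleZE a x i : (a *: x) i = a i *: x i.
Proof. exact: ffunE. Qed.

Lemma prod_module_sumE (J : Type) (r : seq J) (F : J -> prod_module) i :
  (\sum_(j <- r) F j) i = \sum_(j <- r) F j i.
Proof.
elim: r => [|j r IHr]; first by rewrite !big_nil prod_module0E.
by rewrite !big_cons prod_moduleDE IHr.
Qed.

Definition prod_module_of (F : forall i, M i) : prod_module := finfun F.

Lemma prod_module_ofE F i : prod_module_of F i = F i.
Proof. exact: ffunE. Qed.

Definition inj_module i (x : M i) : prod_module :=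
  prod_module_of (dfwith (fun j => 0 : M j) x).

Lemma inj_module_at i (x : M i) : inj_module x i = x.
Proof. by rewrite prod_module_ofE dfwith_in. Qed.

Lemma inj_module_out i j (x : M i) : i != j -> inj_module x j = 0.
Proof. by move=> ij; rewrite prod_module_ofE dfwith_out. Qed.

Lemma inj_moduleP i r (x y : M i) :
  inj_module (r *: x + y) = inj_ring r *: inj_module x + inj_module y.
Proof.
apply/ffunP => j; rewrite prod_moduleDE prod_moduleZE.
have [<-|ij] := eqVneq i j; first by rewrite !inj_module_at inj_ring_at.
by rewrite !inj_module_out // scaler0 addr0.
Qed.

Lemma idem_inj_module i (x : M i) :
  inj_ring (1 : R i) *: inj_module x = inj_module x.
Proof.
apply/ffunP => j; rewrite prod_moduleZE.
have [<-|ij] := eqVneq i j; first by rewrite inj_module_at inj_ring_at scale1r.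
by rewrite inj_module_out // scaler0.
Qed.

Lemma sum_inj_module x : \sum_i inj_module (x i) = x.
Proof.
apply/ffunP => j; rewrite prod_module_sumE (bigD1 j) //= big1.
  by rewrite addr0 inj_module_at.
by move=> i ij; rewrite inj_module_out.
Qed.

End ProductModule.

Section ProductMap.
Variables (M N : forall i, lmodType (R i)) (f : forall i, {linear M i -> N i}).

Lemma prod_map_linear :
  linear (fun x : prod_module M =>
    prod_module_of (fun i => f i (x i)) : prod_module N).
Proof.
move=> a x y; apply/ffunP => i.
by rewrite !(prod_module_ofE, prod_moduleDE, prod_moduleZE) linearP.
Qed.

Definition prod_map : {linear prod_module M -> prod_module N} :=
  linear_of prod_map_linear.

Lemma prod_mapE x i : prod_map x i = f i (x i).
Proof. exact: prod_module_ofE. Qed.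

Lemma prod_map_eq0 x : prod_map x = 0 <-> forall i, f i (x i) = 0.
Proof.
split=> [fx0 i|fx0]; first by rewrite -prod_mapE fx0 prod_module0E.
by apply/ffunP => i; rewrite prod_mapE fx0 prod_module0E.
Qed.

Lemma prod_map_image y :
  (exists x, prod_map x = y) <-> (forall i, exists x, f i x = y i).
Proof.
split=> [[x <-] i|im]; first by exists (x i); rewrite prod_mapE.
exists (prod_module_of (fun i => sval (cid (im i)))).
by apply/ffunP => i; rewrite prod_mapE prod_module_ofE; case: cid.
Qed.

Lemma prod_map_surj : (forall i, surj (f i)) -> surj prod_map.
Proof. by move=> sf y; apply/prod_map_image => i; apply: sf. Qed.

Lemma prod_map_inj : (forall i, injective (f i)) -> injective prod_map.
Proof.
move=> inj_f x y eq_xy; apply/ffunP => i; apply: inj_f.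
by rewrite -!prod_mapE eq_xy.
Qed.

End ProductMap.

Lemma prod_map_exact (U V W : forall i, lmodType (R i))
    (f : forall i, {linear U i -> V i}) (g : forall i, {linear V i -> W i}) :
  (forall i, exact_at (f i) (g i)) -> exact_at (prod_map f) (prod_map g).
Proof.
move=> ex v; rewrite prod_map_eq0 prod_map_image.
by split=> h i; apply/ex.
Qed.

Lemma component_prod_module_linear i (M : forall i, lmodType (R i)) :
  linear (fun x : component i (prod_module M) => cval x i).
Proof.
move=> r x y.
by rewrite cvalD cvalZ_inj prod_moduleDE prod_moduleZE inj_ring_at.
Qed.

Definition component_prod_module i (M : forall i, lmodType (R i)) :
    {linear component i (prod_module M) -> M i} :=
  linear_of (@component_prod_module_linear i M).

Lemma component_prod_module_bij i (M : forall i, lmodType (R i)) :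
  bijective (component_prod_module i M).
Proof.
exists (fun x => cproj i (inj_module x)) => [x|x].
  apply: cval_inj; apply/ffunP => j.
  rewrite /= -[in RHS]idem_cval !prod_moduleZE.
  have [<-|ij] := eqVneq i j; first by rewrite inj_module_at.
  by rewrite inj_ring_out // !scale0r.
by rewrite /= prod_moduleZE inj_ring_at scale1r inj_module_at.
Qed.

(** The bijection between [Hom_R(prod_module M, N)] and the product of the
    [Hom_(R i)(M i, component i N)]. As [I] is finite, the product is also the
    direct sum, so a map out of it is determined by its parts. *)
Section ProductAdjunction.
Variables (M : forall i, lmodType (R i)) (N : lmodType (prod_ring R)).

Lemma glue_linear (h : forall i, {linear M i -> component i N}) :
  linear (fun x : prod_module M => \sum_i cval (h i (x i))).
Proof.
move=> a x y; rewrite scaler_sumr -big_split /=; apply: eq_bigr => i _.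
by rewrite prod_moduleDE prod_moduleZE linearP cvalD cvalZ.
Qed.

Definition glue h : {linear prod_module M -> N} := linear_of (glue_linear h).

Lemma glueE h x : glue h x = \sum_i cval (h i (x i)).
Proof. by []. Qed.

Lemma part_linear (f : {linear prod_module M -> N}) i :
  linear (fun x : M i => cproj i (f (inj_module x))).
Proof.
move=> r x y; apply: cval_inj; rewrite cvalD cvalZ_inj /=.
by rewrite inj_moduleP linearP scalerDr !scalerA mulrC.
Qed.

Definition part f i : {linear M i -> component i N} :=
  linear_of (@part_linear f i).

Lemma cval_part f i x : cval (part f i x) = f (inj_module x).
Proof. by rewrite /= -linearZ idem_inj_module. Qed.

Lemma glue_part f x : glue (part f) x = f x.
Proof.
rewrite glueE -[in RHS](sum_inj_module x) linear_sum.
by apply: eq_bigr => i _; rewrite cval_part.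
Qed.

End ProductAdjunction.

(** The parts of a map are lifted separately and the lifts glued. *)
Lemma prod_module_projective (P : forall i, lmodType (R i)) :
  (forall i, projective (P i)) -> projective (prod_module P).
Proof.
move=> projP M N g f surjg.
have lift i : exists h : {linear P i -> component i M},
    forall x, component_map i g (h x) = part f i x.
  by apply: projP; apply: component_map_surj.
pose h i := sval (cid (lift i)); exists (glue h) => x.
rewrite -[RHS]glue_part !glueE linear_sum; apply: eq_bigr => i _.
by rewrite -cval_component_map (svalP (cid (lift i))).
Qed.

(** Extending [a] along [prod_map g] amounts to extending its parts. *)
Lemma prod_hom_exact (U V W : forall i, lmodType (R i))
    (f : forall i, {linear U i -> V i}) (g : forall i, {linear V i -> W i})
    (Q : lmodType (prod_ring R)) :
  (forall i, hom_exact_at (f i) (g i) (component i Q)) ->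
  hom_exact_at (prod_map f) (prod_map g) Q.
Proof.
move=> ex a; split=> [killa|[b bP] u].
  have ext i : exists b : {linear W i -> component i Q},
      forall v, b (g i v) = part a i v.
    apply/ex => u; apply: cval_inj.
    rewrite cval_part -[RHS](killa (inj_module u)).
    congr (a _); apply/ffunP => j; rewrite prod_mapE.
    have [<-|ij] := eqVneq i j; first by rewrite !inj_module_at.
    by rewrite !inj_module_out ?linear0.
  pose b i := sval (cid (ext i)); exists (glue b) => v.
  rewrite -[RHS]glue_part !glueE; apply: eq_bigr => i _.
  by rewrite prod_mapE (svalP (cid (ext i))).
rewrite -[LHS]glue_part glueE big1 // => i _; rewrite prod_mapE.
suff /(_ (u i)) -> : forall z, part a i (f i z) = 0 by [].
apply/(ex i (part a i)); exists (part b i) => v; apply: cval_inj.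
rewrite !cval_part -bP; congr (b _); apply/ffunP => j; rewrite prod_mapE.
have [<-|ij] := eqVneq i j; first by rewrite !inj_module_at.
by rewrite !inj_module_out ?linear0.
Qed.

(** The product of complete resolutions is one: for projective [Q] over the
    product ring, the test modules [component i Q] are projective. *)
Lemma prod_module_gproj (M : forall i, lmodType (R i)) :
  (forall i, gorenstein_projective (M i)) ->
  gorenstein_projective (prod_module M).
Proof.
move=> gM; pose P i := sval (cid (gM i)).
have exdel i : exists del : forall k, {linear P i k -> P i (k + 1)},
   [/\ forall k, projective (P i k),
        forall k, exact_at (del k) (del (k + 1)),
        forall Q, projective Q ->
          forall k, hom_exact_at (del k) (del (k + 1)) Q
      & iso_image (M i) (del (-1))] by rewrite /P; case: cid.
pose del i := sval (cid (exdel i)).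
have delP i := svalP (cid (exdel i)).
exists (fun k => prod_module (fun i => P i k)).
exists (fun k => prod_map (fun i => del i k)).
split.
- by move=> k; apply: prod_module_projective => i; case: (delP i).
- by move=> k; apply: prod_map_exact => i; case: (delP i).
- move=> Q projQ k; apply: prod_hom_exact => i; case: (delP i) => _ _ hex _.
  by apply: hex; apply: component_projective.
have exphi i : exists phi : {linear M i -> P i (-1 + 1)}, injective phi /\
    forall v, (exists x, phi x = v) <-> (exists u, del i (-1) u = v).
  by case: (delP i) => _ _ _ [phi ? ?]; exists phi.
pose phi i := sval (cid (exphi i)).
have phiP i : injective (phi i) /\
    forall v, (exists x, phi i x = v) <-> (exists u, del i (-1) u = v).
  by rewrite /phi; case: cid.
exists (prod_map phi); first by apply: prod_map_inj => i; case: (phiP i).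
move=> v; rewrite !prod_map_image.
by split=> im i; have [_ eq_im] := phiP i; apply/eq_im.
Qed.

Definition prod_augmented (M : forall i, lmodType (R i))
    (X : forall i, augmented (M i)) : augmented (prod_module M) :=
  Augmented
    (term := fun k => prod_module (fun i => X i k) : lmodType (prod_ring R))
    (fun k => prod_map (fun i => diff (X i) k)) (prod_map (fun i => aug (X i))).

Lemma prod_exact_from M (X : forall i, augmented (M i)) n :
  (forall i, exact_from (X i) n) -> exact_from (prod_augmented X) n.
Proof.
move=> ex; split.
- by apply: prod_map_surj => i; case: (ex i).
- by move=> n_gt0; apply: prod_map_exact => i; case: (ex i) => _ /(_ n_gt0).
by move=> k lt_kn; apply: prod_map_exact => i; case: (ex i) => _ _ /(_ k lt_kn).
Qed.

Lemma prod_gproj_resolution M (X : forall i, augmented (M i)) d :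
  (forall i, gproj_resolution (X i) d) -> gproj_resolution (prod_augmented X) d.
Proof.
move=> res; split=> [k|n|k lt_dk x].
- by apply: prod_module_gproj => i; case: (res i).
- by apply: prod_exact_from => i; case: (res i).
apply/ffunP => i; rewrite prod_module0E.
by case: (res i) => _ _ /(_ k lt_dk).
Qed.

(** This is where a common rank is needed: [R^r] has [(R i)^r] as its
    component for every [i]. *)
Lemma prod_module_fg_free r (U : forall i, lmodType (R i)) :
  (forall i, free_of_rank r (U i)) -> fg_free (prod_module U).
Proof.
move=> frU; pose phi i := sval (cid (frU i)).
have bij_phi i : bijective (phi i) by rewrite /phi; case: cid.
have lin_psi : linear (fun x : 'rV[prod_ring R]_r =>
    prod_module_of (fun i => phi i (map_mx (@coord i) x)) : prod_module U).
  move=> a x y; apply/ffunP => i.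
  rewrite !(prod_moduleDE, prod_moduleZE, prod_module_ofE) -linearP.
  congr (phi i _); apply/rowP => k.
  by rewrite !mxE /coord prod_ringDE prod_ringME.
exists r, (linear_of lin_psi); apply: inj_surj_bijective.
  move=> x y /= eq_xy; apply/rowP => k; apply/ffunP => i.
  have := congr1 (fun z : prod_module U => z i) eq_xy.
  rewrite !prod_module_ofE => /(bij_inj (bij_phi i))/rowP/(_ k).
  by rewrite !mxE.
move=> u; have pre i := bijective_surj (bij_phi i) (u i).
exists (\row_k ([ffun i => sval (cid (pre i)) 0 k] : prod_ring R)).
apply/ffunP => i; rewrite prod_module_ofE.
rewrite -[RHS](svalP (cid (pre i))); congr (phi i _); apply/rowP => k.
by rewrite !mxE /coord ffunE.
Qed.

(** The ranks of the presentations of the [M i] may differ with [i]; padding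
    equalizes them in each degree, and then the product is free. *)
Lemma prod_module_presented n (M : forall i, lmodType (R i)) :
  (forall i, presented n (M i)) -> presented n (prod_module M).
Proof.
move=> presM; pose X i := sval (cid (presM i)).
have frX i k : (k <= n)%N -> fg_free (X i k).
  by rewrite /X; case: cid => /= X' [frX' _]; apply: frX'.
have exX i : exact_from (X i) n by rewrite /X; case: cid => /= X' [].
have rk i : exists r : nat -> nat,
    forall k, (k <= n)%N -> free_of_rank (r k) (X i k).
  have rki k : exists r, (k <= n)%N -> free_of_rank r (X i k).
    have [/(frX i)[r frr]|_] := leqP k n; last by exists 0%N.
    by exists r.
  by have [r rP] := choice rki; exists r.
have [r rP] := choice rk.
(* Adding the ranks over all [i] and all degrees up to [k] gives a bound which
   is independent of [i] and grows fast enough for [presented_of_rank]. *)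
pose s k := (\sum_(j < k.+1) \sum_i r i j)%N.
have exY i : exists Y : augmented (M i),
    (forall k, (k <= n)%N -> free_of_rank (s k) (Y k)) /\ exact_from Y n.
  have [||Y frY exY] := presented_of_rank (s := s) (rP i) (exX i).
  - by rewrite /s big_ord1 (bigD1 i) //= leq_addr.
  - move=> k; rewrite /s [in leqRHS]big_ord_recr /= addnC leq_add2l.
    by rewrite (bigD1 i) //= leq_addr.
  by exists Y.
pose Y i := sval (cid (exY i)).
exists (prod_augmented Y); split.
  move=> k le_kn; apply: (@prod_module_fg_free (s k)) => i.
  by rewrite /Y; case: cid => /= Y' [frY' _]; apply: frY'.
by apply: prod_exact_from => i; rewrite /Y; case: cid => /= Y' [].
Qed.

(** This is the decomposition of [M] as the direct sum of the [e_i M]: the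
    idempotents are orthogonal with sum [1]. *)
Lemma glue_components_bij (M : lmodType (prod_ring R)) :
  exists f : {linear prod_module (fun i => component i M) -> M}, bijective f.
Proof.
have lin_id i : linear (@id (component i M)) by [].
exists (glue (fun i => linear_of (lin_id i))).
apply: inj_surj_bijective => [x y|m].
  move=> /= eq_xy; apply/ffunP => i; apply: cval_inj.
  suff pick (z : prod_module (fun i => component i M)) :
      inj_ring (1 : R i) *: \sum_j cval (z j) = cval (z i).
    by rewrite -!pick eq_xy.
  rewrite scaler_sumr (bigD1 i) //= idem_cval big1 ?addr0 // => j ji.
  rewrite -idem_cval scalerA mul_inj_ring inj_ring_out 1?eq_sym //.
  by rewrite mul0r raddf0 scale0r.
exists (prod_module_of (fun i => cproj i m)); rewrite /= -[RHS]scale1r.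
rewrite -[in RHS](sum_inj_ring 1) scaler_suml; apply: eq_bigr => i _.
by rewrite prod_module_ofE prod_ring1E.
Qed.

(** * Transfer of the G-(n,d) property *)

Lemma G_ring_factor n d i : G_ring (prod_ring R) n d -> G_ring (R i) n d.
Proof.
move=> GR M presM.
(* The family with [M] at [i] and the zero module elsewhere. *)
pose N := dfwith (fun j => 'rV[R j]_0 : lmodType (R j)) M.
have Ni : N i = M by rewrite /N dfwith_in.
have presN j : presented n (N j).
  rewrite /N; case: dfwithP => // {}j _.
  have lin0 : linear (fun _ : 'rV[R j]_0 => 0 : 'rV[R j]_0).
    by move=> a x y; rewrite scaler0 addr0.
  have triv (x : 'rV[R j]_0) : x = 0 by apply: thinmx0.
  exists (Augmented (fun _ => linear_of lin0) (linear_of lin0)); split.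
    by move=> k _; exists 0%N; apply: free_of_rank_row.
  split=> [x|_ x|k _ x]; rewrite ?[x]triv //; first by exists 0.
    by split=> // _; exists 0.
  by split=> // _; exists 0.
have /Gpd_leP[X resX] := GR _ (prod_module_presented presN).
rewrite -Ni; apply/Gpd_leP.
apply: gproj_resolution_iso (component_prod_module_bij i N) _.
by exists (component_augmented i X); apply: component_gproj_resolution.
Qed.

Lemma G_ring_prod n d :
  (forall i, G_ring (R i) n d) -> G_ring (prod_ring R) n d.
Proof.
move=> GR M presM; apply/Gpd_leP.
have res i : exists X : augmented (component i M), gproj_resolution X d.
  by apply/Gpd_leP; apply: GR; apply: component_presented.
have [f bij_f] := glue_components_bij M.
apply: gproj_resolution_iso bij_f _.
exists (prod_augmented (fun i => sval (cid (res i)))).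
by apply: prod_gproj_resolution => i; case: cid.
Qed.

End Product.

Theorem theorem2p7 (m : nat) (R : 'I_m -> comPzRingType) (n d : nat) :
  (G_ring (prod_ring R) n d -> forall i : 'I_m, G_ring (R i) n d) /\
  (esup (fun a => exists i : 'I_m, a = G_gldim (R i)) <> Infty ->
   (forall i : 'I_m, G_ring (R i) n d) -> G_ring (prod_ring R) n d).
Proof.
split=> [GR i|_]; [exact: G_ring_factor | exact: G_ring_prod].
Qed.
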